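(* There exists a Karp reduction (polynomial-time many-one reduction) from the decision problem K$^{\text{th}}$ Largest Subset to the complement of the decision problem General Variable Branching (GVB). That is, there is a polynomial-time computable map sending each instance of K$^{\text{th}}$ Largest Subset to an instance of GVB such that the answer to the former is YES if and only if the answer to the latter is NO.
   Context: All integers are encoded in binary. K$^{\text{th}}$ Largest Subset. Input: a finite set $A$ with $N$ elements, a size $s(a) \in \mathbb{Z}^+$ for each $a \in A$, positive integers $K$ and $B$. Question: are there $K$ or more distinct subsets $A' \subseteq A$ for which the sum of the sizes of the elements of $A'$ does not exceed $B$? A variable is a pair $(l,r)$ of integers with $1 \le l \le r$. A branch-and-bound (B&B) tree is a vertex-weighted full binary tree in which each internal node is associated with a variable $(l,r)$, such that an internal node of weight $g$ has children of weights $g+l$ and $g+r$; the root has weight $0$. The tree closes the gap $G$ if all its leaves have weight at least $G$. General Variable Branching (GVB). Input: $n$ variables $(l_i,r_i)$, $i=1,\dots,n$, an integer $G>0$, an integer $k>0$, and a vector of multiplicities $m \in \mathbb{Z}_{>0}^n$. Question: is there a B&B tree with at most $k$ nodes that closes the gap $G$, branching on each variable $i$ at most $m_i$ times on each path from the root to a leaf? *)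

(* Defs.v *)
From mathcomp Require Import all_boot.

Set Implicit Arguments.
Unset Strict Implicit.
Unset Printing Implicit Defensive.

(* Words over the alphabet {0, 1, #}: [Some b] is a bit, [None] is '#'. *)
Definition symbol : finType := option bool.
Definition word := seq symbol.

(** * Deterministic multi-tape Turing machines *)

Variant move := MoveLeft | MoveRight | Stay.

(* [tm_extra] holds the work symbols beyond {0, 1, #}. *)
Record tm := TM {
  tm_state : finType;
  tm_tape  : finType;
  tm_extra : finType;
  tm_start : tm_state;
  tm_halt  : pred tm_state;
  tm_in    : tm_tape;
  tm_out   : tm_tape;
  tm_trans : tm_state -> {ffun tm_tape -> option (symbol + tm_extra)} ->
             tm_state * {ffun tm_tape -> option (symbol + tm_extra) * move} }.

(* A cell holding [None] is blank. *)
Definition cell (M : tm) := option (symbol + tm_extra M).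

(* A two-way infinite tape: the cells left of the head, nearest first, and the
   cells from the scanned one rightwards; all the cells not listed are blank. *)
Definition tape (M : tm) := (seq (cell M) * seq (cell M))%type.

Definition scan (M : tm) (t : tape M) : cell M := head None t.2.

Definition write_move (M : tm) (t : tape M) (a : cell M * move) : tape M :=
  let: (c, d) := a in
  match d with
  | MoveLeft => (behead t.1, head None t.1 :: c :: behead t.2)
  | MoveRight => (c :: t.1, behead t.2)
  | Stay => (t.1, c :: behead t.2)
  end.

Definition config (M : tm) := (tm_state M * {ffun tm_tape M -> tape M})%type.

Definition step (M : tm) (c : config M) : config M :=
  if tm_halt c.1 then c else
  let: (q, a) := tm_trans c.1 [ffun i => scan (c.2 i)] in
  (q, [ffun i => write_move (c.2 i) (a i)]).

Definition word_cells (M : tm) (w : word) : seq (cell M) :=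
  [seq Some (inl x) | x <- w].

Definition init_config (M : tm) (w : word) : config M :=
  (tm_start M,
   [ffun i => ([::], if i == tm_in M then word_cells M w else [::])]).

(* The output is the block of cells from the head to the next blank cell. *)
Definition output_cells (M : tm) (c : config M) : seq (cell M) :=
  let r := (c.2 (tm_out M)).2 in take (find (pred1 None) r) r.

Definition tm_computes_within (M : tm) (w w' : word) (t : nat) : Prop :=
  let c := iter t (@step M) (init_config M w) in
  tm_halt c.1 /\ output_cells c = word_cells M w'.

(** * Decision problems and Karp reductions *)

Record problem := Problem {
  instance : Type;
  encode : instance -> word;
  encode_inj : injective encode;
  answer : instance -> Prop }.

Definition complement (P : problem) : problem :=
  Problem (@encode_inj P) (fun x => ~ answer x).

Definition polytime (P Q : problem) (f : instance P -> instance Q) : Prop :=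
  exists (M : tm) (c d : nat), forall x : instance P,
    tm_computes_within M (encode x) (encode (f x))
                       (c * size (encode x) ^ d + c).

Definition karp_reducible (P Q : problem) : Prop :=
  exists f : instance P -> instance Q,
    polytime f /\ forall x : instance P, answer x <-> answer (f x).

(** * Binary encoding of tuples of integers *)

(* Least significant bit first, without leading zeros. *)
Definition bits (n : nat) : seq bool :=
  mkseq (fun i => odd (n %/ 2 ^ i)) (up_log 2 n.+1).

Definition encode_nat (n : nat) : word := rcons (map Some (bits n)) None.

Definition encode_nats (s : seq nat) : word := flatten (map encode_nat s).

Lemma odd_divn_inj m n :
  (forall i, odd (m %/ 2 ^ i) = odd (n %/ 2 ^ i)) -> m = n.
Proof.
elim/ltn_ind: m n => m IH n E.
have E0 : odd m = odd n by move: (E 0); rewrite !expn0 !divn1.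
have E2 : forall i, odd (m./2 %/ 2 ^ i) = odd (n./2 %/ 2 ^ i).
  by move=> i; move: (E i.+1); rewrite expnS !divnMA !divn2.
case: m => [|m] in IH E E0 E2 *; last first.
  have lt : (m.+1)./2 < m.+1 by rewrite ltn_half_double -addnn addSn ltnS leq_addl.
  by rewrite -(odd_double_half m.+1) -[RHS]odd_double_half E0 (IH _ lt _ E2).
apply/eqP; rewrite eq_sym -leqn0 leqNgt; apply/negP => n_gt0.
have [/= lo hi] := andP (trunc_log_bounds (isT : 1 < 2) n_gt0).
move: (E (trunc_log 2 n)); rewrite div0n.
suff -> : n %/ 2 ^ trunc_log 2 n = 1 by [].
apply/eqP; rewrite eqn_leq -ltnS ltn_divLR ?expn_gt0 // -expnS hi.
by rewrite divn_gt0 ?expn_gt0.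
Qed.

Lemma bits_inj : injective bits.
Proof.
have bitsE k i : nth false (bits k) i = odd (k %/ 2 ^ i).
  have [lt_i|le_i] := ltnP i (up_log 2 k.+1); first by rewrite nth_mkseq.
  rewrite nth_default ?size_mkseq // divn_small //.
  by apply: leq_trans (up_logP k.+1 (isT : 1 < 2)) _; rewrite leq_exp2l.
by move=> m n E; apply: odd_divn_inj => i; rewrite -!bitsE E.
Qed.

Lemma encode_nats_inj : injective encode_nats.
Proof.
have cat_inj (a b : seq bool) (u v : word) :
    rcons (map Some a) None ++ u = rcons (map Some b) None ++ v ->
    a = b /\ u = v.
  elim: a b => [|x a IH] [|y b] //=; first by case.
  by case=> -> /IH[-> ->].
elim=> [|m s IH] [|n s'] //=; rewrite /encode_nats /= /encode_nat.
- by case: (bits n).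
- by case: (bits m).
- by move=> /cat_inj[/bits_inj -> /IH ->].
Qed.

(** * K-th largest subset *)

(* The finite set A is taken to be 'I_N. *)
Record kls_instance := KLSInstance {
  kls_N : nat;
  kls_size : kls_N.-tuple nat;
  kls_K : nat;
  kls_B : nat;
  kls_size_gt0 : [forall a, 0 < tnth kls_size a];
  kls_K_gt0 : 0 < kls_K;
  kls_B_gt0 : 0 < kls_B }.

Definition kls_encode (x : kls_instance) : word :=
  encode_nats (kls_K x :: kls_B x :: kls_size x).

Lemma kls_encode_inj : injective kls_encode.
Proof.
move=> [N s K B h1 h2 h3] [N' s' K' B' h1' h2' h3'] /encode_nats_inj /= [].
move=> EK EB Es; have EN : N = N' by rewrite -(size_tuple s) Es size_tuple.
move: Es; subst=> /val_inj Es; subst.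
by congr KLSInstance; apply: bool_irrelevance.
Qed.

Definition kls_answer (x : kls_instance) : Prop :=
  kls_K x <= #|[set A' : {set 'I_(kls_N x)} |
                 \sum_(a in A') tnth (kls_size x) a <= kls_B x]|.

Definition kth_largest_subset : problem := Problem kls_encode_inj kls_answer.

(** * General variable branching *)

(* Each node carries its weight; internal nodes also carry the index of the
   variable branched on. *)
Inductive bbtree (n : nat) :=
| Leaf of nat
| Node of nat & 'I_n & bbtree n & bbtree n.

Definition root_weight n (t : bbtree n) : nat :=
  match t with Leaf g => g | Node g _ _ _ => g end.

Fixpoint weights_ok n (v : n.-tuple (nat * nat)) (t : bbtree n) : bool :=
  if t is Node g i t1 t2 then
    [&& root_weight t1 == g + (tnth v i).1, root_weight t2 == g + (tnth v i).2,
        weights_ok v t1 & weights_ok v t2]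
  else true.

Definition is_bbtree n (v : n.-tuple (nat * nat)) (t : bbtree n) : bool :=
  (root_weight t == 0) && weights_ok v t.

Fixpoint leaf_weights n (t : bbtree n) : seq nat :=
  match t with
  | Leaf g => [:: g]
  | Node _ _ t1 t2 => leaf_weights t1 ++ leaf_weights t2
  end.

Definition closes_gap n (G : nat) (t : bbtree n) : bool :=
  all (leq G) (leaf_weights t).

Fixpoint node_count n (t : bbtree n) : nat :=
  if t is Node _ _ t1 t2 then (node_count t1 + node_count t2).+1 else 1.

(* The sequences of variables branched on along the root-to-leaf paths. *)
Fixpoint branchings n (t : bbtree n) : seq (seq 'I_n) :=
  if t is Node _ i t1 t2 then
    [seq i :: p | p <- branchings t1 ++ branchings t2]
  else [:: [::]].

Definition respects_mult n (m : n.-tuple nat) (t : bbtree n) : bool :=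
  all (fun p => [forall i, count_mem i p <= tnth m i]) (branchings t).

Record gvb_instance := GVBInstance {
  gvb_n : nat;
  gvb_var : gvb_n.-tuple (nat * nat);
  gvb_G : nat;
  gvb_k : nat;
  gvb_m : gvb_n.-tuple nat;
  gvb_var_ok : [forall i, 1 <= (tnth gvb_var i).1 <= (tnth gvb_var i).2];
  gvb_G_gt0 : 0 < gvb_G;
  gvb_k_gt0 : 0 < gvb_k;
  gvb_m_gt0 : [forall i, 0 < tnth gvb_m i] }.

Definition gvb_encode (y : gvb_instance) : word :=
  encode_nats (gvb_G y :: gvb_k y ::
    flatten [seq [:: x.1.1; x.1.2; x.2] | x <- zip (gvb_var y) (gvb_m y)]).

Lemma gvb_encode_inj : injective gvb_encode.
Proof.
move=> [n v G k m h1 h2 h3 h4] [n' v' G' k' m' h1' h2' h3' h4'].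
move=> /encode_nats_inj /= [EG Ek Ef].
have flat_inj (s s' : seq (nat * nat * nat)) :
    flatten [seq [:: x.1.1; x.1.2; x.2] | x <- s] =
    flatten [seq [:: x.1.1; x.1.2; x.2] | x <- s'] -> s = s'.
  elim: s s' => [|[[a b] c] s IH] [|[[a' b'] c'] s'] //=.
  by case=> -> -> -> /IH ->.
have Ez := flat_inj _ _ Ef.
have Ev : v = v' :> seq _.
  rewrite -(unzip1_zip (s := v) (t := m)) ?size_tuple // Ez.
  by rewrite unzip1_zip ?size_tuple.
have Em : m = m' :> seq _.
  rewrite -(unzip2_zip (s := v) (t := m)) ?size_tuple // Ez.
  by rewrite unzip2_zip ?size_tuple.
have En : n = n' by rewrite -(size_tuple v) Ev size_tuple.
move: Ev Em; clear Ef Ez; subst=> /val_inj Ev /val_inj Em; subst.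
by congr GVBInstance; apply: bool_irrelevance.
Qed.

Definition gvb_answer (y : gvb_instance) : Prop :=
  exists t : bbtree (gvb_n y),
    [/\ is_bbtree (gvb_var y) t, closes_gap (gvb_G y) t,
        node_count t <= gvb_k y & respects_mult (gvb_m y) t].

Definition gvb : problem := Problem gvb_encode_inj gvb_answer.

(* Main.v *)
Require Import Defs.
From HB Require Import structures.
From mathcomp Require Import all_boot zify.

(** Let the elements of A have sizes s_1, ..., s_N and let w be the encoded
    instance, of length L.  Give the tree variables (M_j, M_j + d_j), each
    usable once per path, with the M_j so large that a path closes the gap
    sum_j M_j + T only after using all of them.  A path that has used them all
    has weight sum_j M_j + d(A'), where A' collects the variables at which it
    went right.  If d(A') >= T it may stop there; otherwise it needs one more
    branching, for which there is a single extra variable (X, X) with X >= T.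
    So the smallest closing tree with n such variables is a complete tree of
    depth n with two more nodes below each light path, and has
    2^(n+1) - 1 + 2 C nodes, where C is the number of subsets A' with
    d(A') < T.  The lower bound must allow for trees that choose different
    variables on different paths and that use the extra variable early; it is
    an induction on the tree over the list of variables still unused
    (node_count_lb), because C, as a function of that list, satisfies
    the Pascal-like recursion of light for any element of the list.

    Deciding C < K is then asking for a tree with at most
    2^(n+1) - 1 + 2 K - 2 nodes.  The rest of the design keeps the arithmetic
    trivial, so that a Turing machine needs no addition:
    - B itself is added to the sizes.  With threshold B + 1 this adds exactly
      one light set, the singleton of B, and turns K - 1 into K.
    - All sizes are doubled and the threshold is 2 B + 1: in binary this
      prepends a 0 or a 1.
    - L + 1 fillers of size 2^L > B are added.  They lie in no light set, but
      they make n larger than the number of bits of K, so that 2^(n+1) + 2 K is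
      written by padding the bits of K with zeros.
    - The M_j are consecutive powers of two, the smallest one taken twice, so
      that their sum is again a power of two.
    Apart from the multiplicities, every number of the new instance is thus
    2^(m+1) + 2 x or 2^(m+1) + 2 x + 1 with x < 2^m: in binary, a first bit, the
    bits of x padded with zeros to length m, and a final 1 (encode_field).

    A machine with four tapes writes these words.  One tape U holds a block of
    length m, over which a field is paced; it grows by one cell after each
    variable.  One tape V counts the variables.  The variables are written
    from left to right; then K and B are copied onto V and U, whose contents
    are written from right to left in front of the variables, which leaves the
    output head on the first cell of the output.  Each loop of the machine is
    described by a lemma about an abstract step function on tapes without
    superfluous blanks, which the actual machine simulates (models_step). *)

Set Implicit Arguments.
Unset Strict Implicit.
Unset Printing Implicit Defensive.

(** * Counting light subfamilies *)

(** The number of subfamilies of ds with sum less than T.  Truncated subtraction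
    is right here: once T - d is 0 the budget is exhausted and all
    counts vanish, as light0 shows. *)
Fixpoint light (ds : seq nat) (T : nat) : nat :=
  if ds is d :: ds' then light ds' T + light ds' (T - d) else 0 < T.

Lemma light0 ds : light ds 0 = 0.
Proof. by elim: ds => //= d ds IH; rewrite sub0n IH. Qed.

Lemma light_le ds T : light ds T <= 2 ^ size ds.
Proof.
elim: ds T => [|d ds IH] T /=; first by case: (0 < T).
by rewrite expnS mul2n -addnn leq_add.
Qed.

(** A tree may branch on any unused variable, so the recursion of light is
    needed at an arbitrary position of the list. *)
Lemma light_rem (I : eqType) (d : I -> nat) i (R : seq I) T :
  i \in R -> light (map d R) T = light (map d (i :: rem i R)) T.
Proof.
elim: R T => //= j R IH T; rewrite inE eq_sym; case: eqP => [-> //|_] /= iR.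
by rewrite !IH //= subnAC addnACA.
Qed.

Lemma light_cat_heavy ds es T :
  all (leq T) ds -> light (ds ++ es) T = light es T.
Proof.
elim: ds => //= d ds IH /andP[le_d /IH ->].
by move: le_d; rewrite -subn_eq0 => /eqP ->; rewrite light0 addn0.
Qed.

Lemma light1 ds : all (leq 1) ds -> light ds 1 = 1.
Proof. by move=> h; rewrite -(cats0 ds) light_cat_heavy. Qed.

(** Doubling the sizes leaves room for the odd threshold 2 T - 1, which has
    the same light subfamilies as T. *)
Lemma light_double ds T : light (map double ds) T.*2.-1 = light ds T.
Proof.
elim: ds T => [|d ds IH] T /=; first by case: T.
by rewrite IH (_ : T.*2.-1 - d.*2 = (T - d).*2.-1) ?IH //; lia.
Qed.

(** Subsets of i :: R are split by membership of i; those containing i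
    correspond to subsets of R with the budget reduced by s i. *)
Lemma card_light (I : finType) (s : I -> nat) (R : seq I) T : uniq R ->
  #|[set A : {set I} | (A \subset R) && (\sum_(a in A) s a < T)]| =
  light (map s R) T.
Proof.
elim: R T => [|i R IH] T /=.
  move=> _; case: T => [|T].
    by apply/eqP; rewrite cards_eq0; apply/eqP/setP=> A; rewrite !inE ltn0 andbF.
  rewrite (_ : [set A | _] = [set set0]) ?cards1 //.
  apply/setP=> A; rewrite !inE; apply/andP/eqP => [[/subsetP sA _]|->].
    by apply/setP=> a; rewrite inE; apply/negP=> /sA.
  by rewrite big_set0; split=> //; apply/subsetP=> a; rewrite inE.
case/andP=> iR uR; rewrite -!IH //.
rewrite -[LHS](cardsID [set A : {set I} | i \in A]) addnC; congr addn.
  apply: eq_card => A; rewrite !inE; case: (boolP (i \in A)) => iA /=.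
    by symmetry; apply/negP=> /andP[/subsetP/(_ i iA)]; rewrite (negPf iR).
  congr (_ && _); apply/subsetP/subsetP=> sA a aA; move: (sA a aA).
    by rewrite inE; case: eqP => [E|//]; rewrite E (negPf iA) in aA.
  by rewrite inE orbC => ->.
set S := [set A : {set I} | (A \subset R) && (\sum_(a in A) s a < T - s i)].
rewrite -(card_in_imset (f := fun A => i |: A) (D := mem S)); last first.
  move=> A A'; rewrite !inE => /andP[sA _] /andP[sA' _] E.
  have niA (X : {set I}) : X \subset R -> i \notin X.
    by move/subsetP=> sX; apply: contra iR => /sX.
  by rewrite -(setU1K (niA _ sA)) E setU1K ?niA.
apply: eq_card => A; rewrite !inE; apply/andP/imsetP => [[/andP[sA wA] iA]|[A']].
  exists (A :\ i); rewrite ?setD1K // inE; apply/andP; split.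
    apply/subsetP=> a; rewrite !inE => /andP[ai aA].
    by move/subsetP/(_ a aA): sA; rewrite inE (negPf ai).
  by move: wA; rewrite (big_setD1 i) //=; lia.
rewrite inE => /andP[sA' wA'] ->; rewrite setU11; split=> //.
have niA : i \notin A' by apply: contra iR; move/subsetP: sA' => /(_ i).
rewrite big_setU1 //=; apply/andP; split; last by lia.
apply/subsetP=> a; rewrite in_setU1 inE; case: eqP => //= _.
by move/subsetP: sA'; exact.
Qed.

Lemma kls_answerE x :
  kls_answer x <-> kls_K x <= light (kls_size x) (kls_B x).+1.
Proof.
rewrite /kls_answer -[in light _](map_tnth_enum (kls_size x)).
rewrite -card_light ?enum_uniq //.
rewrite (eq_card (B := [set A' : {set 'I_(kls_N x)} |
   \sum_(a in A') tnth (kls_size x) a <= kls_B x])) // => A.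
rewrite !inE ltnS (_ : A \subset _) //.
by apply/subsetP=> a; rewrite mem_enum.
Qed.

(** * The smallest closing tree *)

Section Trees.
Variables (n : nat) (v : n.-tuple (nat * nat)).
Implicit Types (t : bbtree n) (R : seq 'I_n) (i : 'I_n).

Let M i := (tnth v i).1.
Let d i := (tnth v i).2 - (tnth v i).1.

(** The multiplicity constraint, with the variables still available given as a
    list: this form passes to subtrees by deleting an element of the list. *)
Definition fits R t : bool :=
  all (fun p => [forall i, count_mem i p <= count_mem i R]) (branchings t).

Lemma branchings_neq0 t : branchings t != [::].
Proof. by elim: t => //= _ i t1 IH1 t2 _; case: (branchings t1) IH1. Qed.

Lemma fits_node R g i t1 t2 :
  fits R (Node g i t1 t2) = [&& i \in R, fits (rem i R) t1 & fits (rem i R) t2].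
Proof.
rewrite /fits /= all_map -all_cat.
have [iR|iR] /= := boolP (i \in R).
  apply: eq_all => p /=; apply: eq_forallb => j.
  rewrite count_mem_rem /=; case: eqVneq => [<-|_] /=; last by rewrite subn0.
  have: 0 < count_mem i R by rewrite -has_count has_pred1.
  by case: (count_mem i R) => // c _; rewrite add1n subn1.
case: (branchings t1) (branchings_neq0 t1) => //= p ps _.
apply/negP=> /andP[/forallP/(_ i)] /=.
by rewrite eqxx (count_memPn iR).
Qed.

Definition above R (b : nat) : Prop := forall i, i \in R -> b <= M i /\ M i <= (tnth v i).2.

Lemma above_rem R b i : above R b -> above (rem i R) b.
Proof. by move=> aR j /mem_rem; exact: aR. Qed.

Variables (T H b : nat).
Hypothesis T_gt0 : 0 < T.

Lemma sum_rem (f : 'I_n -> nat) R i : i \in R ->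
  sumn (map f R) = f i + sumn (map f (rem i R)).
Proof. by move/perm_to_rem/(perm_map f)/perm_sumn ->. Qed.

Lemma size_rem_succ R i : i \in R -> (size (rem i R)).+1 = size R.
Proof. by move=> iR; rewrite size_rem // prednK; case: (R) iR. Qed.

Lemma right_weight R i : above R b -> i \in R -> (tnth v i).2 = M i + d i.
Proof. by move=> aR /aR[_ le]; rewrite /d subnKC. Qed.

(** Below a node where the variables of R are still unused, no leaf can close
    the gap H + T before using all of R: the surplus u of the weight over the
    part of H collected so far is at most b, and each missing variable costs at
    least b. *)
Lemma node_count_full t R u :
    above R b -> u + sumn (map d R) <= b ->
    root_weight t + sumn (map M R) = H + u ->
    weights_ok v t -> closes_gap (H + T) t -> fits R t ->
  2 ^ (size R).+1 <= (node_count t).+1.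
Proof.
elim: t R u => [g|g i t1 IH1 t2 IH2] R u aR leb /= gE.
  move=> _; rewrite /closes_gap /= andbT => clg _.
  case: R aR leb gE => //= i R aR leb gE.
  by have [] := aR i (mem_head _ _); rewrite -/(M i); lia.
case/and4P=> /eqP g1 /eqP g2 w1 w2; rewrite /closes_gap /= all_cat => /andP[c1 c2].
rewrite fits_node => /and3P[iR f1 f2].
rewrite (sum_rem M iR) in gE; rewrite (sum_rem d iR) in leb.
have aR' := above_rem (i := i) aR.
rewrite (right_weight aR iR) in g2; rewrite -/(M i) in g1.
have h1 : 2 ^ (size (rem i R)).+1 <= (node_count t1).+1.
  by apply: (IH1 _ u) => //; lia.
have h2 : 2 ^ (size (rem i R)).+1 <= (node_count t2).+1.
  by apply: (IH2 _ (u + d i)) => //; lia.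
move: h1 h2; rewrite (size_rem_succ iR).
by rewrite [2 ^ _.+1]expnS => h1 h2; lia.
Qed.

Variables (x : 'I_n).
Let X := M x.
Hypothesis xE : (tnth v x).2 = X.

(** While the extra variable x is unused, the nodes below are counted by
    induction on the tree.  Branching on some i in R follows the recursion of
    light.  Branching on x cannot help: both children must still
    use all of R, and the resulting second complete tree outweighs the bound
    light <= 2 ^ size R. *)
Lemma node_count_lb t R u :
    above R b -> u + sumn (map d R) + X <= b ->
    root_weight t + sumn (map M R) = H + u ->
    weights_ok v t -> closes_gap (H + T) t -> fits (x :: R) t ->
  2 ^ (size R).+1 + 2 * light (map d R) (T - u) <= (node_count t).+1.
Proof.
elim: t R u => [g|g i t1 IH1 t2 IH2] R u aR leb /= gE.
  move=> _; rewrite /closes_gap /= andbT => clg _.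
  case: R aR leb gE => /= [|i R] aR leb gE.
    by rewrite (_ : T - u = 0) //; lia.
  by have [] := aR i (mem_head _ _); rewrite -/(M i); lia.
case/and4P=> /eqP g1 /eqP g2 w1 w2; rewrite /closes_gap /= all_cat => /andP[c1 c2].
rewrite fits_node => /and3P[ixR f1 f2].
(* Once x is used its weight counts as surplus. *)
have [E|ix] := eqVneq i x.
  rewrite E /= eqxx in f1 f2; rewrite E xE in g2; rewrite E -/(M x) -/X in g1.
  have h1 := node_count_full (t := t1) (u := u + X) aR _ _ w1 c1 f1.
  have h2 := node_count_full (t := t2) (u := u + X) aR _ _ w2 c2 f2.
  have := light_le (map d R) (T - u); rewrite size_map.
  move: (h1 ltac:(lia) ltac:(lia)) (h2 ltac:(lia) ltac:(lia)).
  by rewrite [2 ^ _.+1]expnS => a1 a2 a3; lia.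
have iR : i \in R by move: ixR; rewrite inE (negPf ix).
rewrite (sum_rem M iR) in gE; rewrite (sum_rem d iR) in leb.
rewrite (light_rem _ _ iR) /=.
rewrite /= eq_sym (negPf ix) in f1 f2.
have aR' := above_rem (i := i) aR.
rewrite (right_weight aR iR) in g2; rewrite -/(M i) in g1.
have := IH1 (rem i R) u aR' ltac:(lia) ltac:(lia) w1 c1 f1.
have := IH2 (rem i R) (u + d i) aR' ltac:(lia) ltac:(lia) w2 c2 f2.
rewrite (size_rem_succ iR).
by rewrite [2 ^ _.+1]expnS subnDA => h1 h2; lia.
Qed.

(** The tree attaining the bound: it uses the variables of R in their order and
    the extra variable x only at the light leaves. *)
Fixpoint greedy_tree R (g : nat) : bbtree n :=
  if R is i :: R' then
    Node g i (greedy_tree R' (g + (tnth v i).1)) (greedy_tree R' (g + (tnth v i).2))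
  else if H + T <= g then Leaf n g else Node g x (Leaf n (g + X)) (Leaf n (g + X)).

Lemma greedy_root R g : root_weight (greedy_tree R g) = g.
Proof. by case: R => //=; case: ifP. Qed.

Lemma greedy_weights R g : weights_ok v (greedy_tree R g).
Proof.
elim: R g => [|i R IH] g /=; last by rewrite !greedy_root !eqxx !IH.
by case: ifP => //= _; rewrite xE !eqxx.
Qed.

Lemma greedy_fits R g : fits (x :: R) (greedy_tree R g).
Proof.
elim: R g => [|i R IH] g /=.
  case: ifP => _; first by apply/allP=> p; rewrite inE => /eqP ->; apply/forallP.
  by rewrite fits_node inE eqxx /= !andbb; apply/allP=> p; rewrite inE => /eqP ->; apply/forallP.
rewrite fits_node !inE eqxx orbT /=.
by case: eqP => [<-|_]; rewrite ?eqxx !IH.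
Qed.

Lemma greedy_closes R g u : T <= X -> above R b ->
  g + sumn (map M R) = H + u -> closes_gap (H + T) (greedy_tree R g).
Proof.
move=> TX; elim: R g u => [|i R IH] g u aR /= gE; rewrite /closes_gap.
  by case: ifP => /= h; rewrite ?h ?andbT //; lia.
have aR' : above R b by move=> j jR; apply: aR; rewrite inE jR orbT.
rewrite /= all_cat; apply/andP; split; first by apply: (IH _ u aR'); rewrite -/(M i); lia.
by rewrite (right_weight aR) ?mem_head //; apply: (IH _ (u + d i) aR'); lia.
Qed.

Lemma greedy_count R g u : above R b -> g + sumn (map M R) = H + u ->
  (node_count (greedy_tree R g)).+1 = 2 ^ (size R).+1 + 2 * light (map d R) (T - u).
Proof.
elim: R g u => [|i R IH] g u aR /= gE.
  by case: ifP => h /=; case: ltnP => //; lia.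
have aR' : above R b by move=> j jR; apply: aR; rewrite inE jR orbT.
have h1 := IH (g + (tnth v i).1) u aR'.
have h2 := IH (g + (tnth v i).2) (u + d i) aR'.
move: h1 h2; rewrite (right_weight aR) ?mem_head // -/(M i) => h1 h2.
move: (h1 ltac:(lia)) (h2 ltac:(lia)).
by rewrite [2 ^ (size R).+2]expnS subnDA; lia.
Qed.

End Trees.

Definition spread (p : nat * nat) := p.2 - p.1.

(** The two bounds together, with the extra variable p in position 0 and all
    variables available once. *)
Lemma closing_tree_iff (p : nat * nat) (vs : seq (nat * nat)) b H T k :
    0 < T <= p.1 -> p.2 = p.1 ->
    (forall q, q \in vs -> b <= q.1 <= q.2) ->
    sumn (map spread vs) + p.1 <= b -> sumn (map fst vs) = H ->
  (exists t : bbtree (size (p :: vs)),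
     [/\ is_bbtree (in_tuple (p :: vs)) t, closes_gap (H + T) t, node_count t <= k
       & respects_mult (nseq_tuple (size (p :: vs)) 1) t]) <->
  2 ^ (size vs).+1 + 2 * light (map spread vs) T <= k.+1.
Proof.
move=> /andP[T0 Tp] p2 vs_b leb HE; set v := in_tuple _.
(* The positions of vs in p :: vs. *)
pose R := map (lift ord0) (enum 'I_(size vs)).
have RE (A : Type) (f : nat * nat -> A) : map (fun i => f (tnth v i)) R = map f vs.
  rewrite -map_comp -[in RHS](in_tupleE vs) -[in RHS](map_tnth_enum (in_tuple vs)).
  by rewrite -map_comp; apply: eq_map => i /=; rewrite !(tnth_nth p).
have sR : size R = size vs by rewrite size_map size_enum_ord.
have aR : above v R b.
  move=> _ /mapP[i _ ->]; apply/andP; apply: vs_b.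
  rewrite (_ : tnth v _ = nth p vs i); last by rewrite (tnth_nth p).
  exact: mem_nth.
have xE : tnth v ord0 = p by rewrite (tnth_nth p).
have fitsE t : respects_mult (nseq_tuple _ 1) t = fits (ord0 :: R) t.
  rewrite /respects_mult /fits -enum_ordSl; apply: eq_all => q.
  apply: eq_forallb => i; rewrite (tnth_nth 0) nth_nseq ltn_ord.
  have once (j : 'I_(size vs).+1) : count_mem j (enum 'I_(size vs).+1) = 1.
    by rewrite count_uniq_mem ?enum_uniq // mem_enum.
  by congr (_ <= _); exact/esym/once.
have sumM := RE _ fst; have sumd := RE _ spread.
have x_same : (tnth v ord0).2 = (tnth v ord0).1 by rewrite xE.
split=> [[t [/andP[/eqP r0 w] c le f]]|le].
  rewrite fitsE in f.
  have := @node_count_lb _ v T H b T0 ord0 x_same t R 0 aR.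
  rewrite sumM sumd xE sR subn0 add0n r0 => /(_ leb).
  rewrite !addn0 => /(_ HE w c f) h.
  exact: leq_trans h _.
exists (greedy_tree v T H ord0 R 0); split.
- by rewrite /is_bbtree greedy_root greedy_weights // xE.
- apply: (@greedy_closes _ v T H b T0 ord0 x_same R 0 0); rewrite /= ?xE //.
  by rewrite sumM; lia.
- have := @greedy_count _ v T H b T0 ord0 x_same R 0 0 aR.
  by rewrite sumM sumd sR subn0 => h; rewrite -ltnS h //; lia.
- by rewrite fitsE greedy_fits.
Qed.

(** * The reduced instance *)

Definition gap_var m x : nat * nat := (2 ^ m.+1, 2 ^ m.+1 + x.*2).

Fixpoint gap_vars m xs : seq (nat * nat) :=
  if xs is x :: xs' then gap_var m x :: gap_vars m.+1 xs' else [::].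

Lemma size_gap_vars m xs : size (gap_vars m xs) = size xs.
Proof. by elim: xs m => //= x xs IH m; rewrite IH. Qed.

Lemma spread_gap_vars m xs : map spread (gap_vars m xs) = map double xs.
Proof. by elim: xs m => //= x xs IH m; rewrite IH /spread /= addKn. Qed.

(** Taking the smallest power twice makes the sum of consecutive powers of two
    collapse to a single power. *)
Lemma sum_gap_vars m xs :
  2 ^ m.+1 + sumn (map fst (gap_vars m xs)) = 2 ^ (m + size xs).+1.
Proof.
elim: xs m => [|x xs IH] m /=; first by rewrite !addn0.
by rewrite addnA addnn -mul2n -expnS IH addSnnS.
Qed.

Lemma gap_vars_ge m xs q : q \in gap_vars m xs -> 2 ^ m.+1 <= q.1 <= q.2.
Proof.
elim: xs m => //= x xs IH m; rewrite inE => /orP[/eqP ->|/IH /andP[h ->]] /=.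
  by rewrite leqnn leq_addr.
by rewrite andbT (leq_trans _ h) // leq_exp2l.
Qed.

Lemma bits_double (b : bool) y : 0 < y -> bits (b + y.*2) = b :: bits y.
Proof.
move=> y0; rewrite /bits.
have -> : up_log 2 (b + y.*2).+1 = (up_log 2 y.+1).+1.
  apply/eqP; rewrite eqn_leq; apply/andP; split.
    apply: up_log_min => //; rewrite expnS.
    by have := up_logP y.+1 (isT : 1 < 2); case: b => ?; lia.
  have gt0 : 0 < up_log 2 (b + y.*2).+1 by rewrite up_log_gt0; lia.
  rewrite -(prednK gt0) ltnS; apply: up_log_min => //.
  have := up_logP (b + y.*2).+1 (isT : 1 < 2).
  by rewrite -[in X in _ <= X -> _](prednK gt0) expnS; case: (b) => ?; lia.
rewrite /mkseq /= expn0 divn1 oddD odd_double addbF oddb; congr (_ :: _).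
rewrite -[1]addn0 iotaDl -map_comp; apply: eq_map => i /=.
rewrite add1n expnS divnMA divn2; congr (odd (_ %/ _)).
by case: b; rewrite ?add1n ?add0n ?uphalf_double ?doubleK //=; lia.
Qed.

Lemma bits0 : bits 0 = [::]. Proof. by []. Qed.
Lemma bits1 : bits 1 = [:: true]. Proof. by []. Qed.

Definition pad m (s : seq bool) := s ++ nseq (m - size s) false.

(** A leading power of two turns binary notation into a fixed-width field. *)
Lemma bits_pow m x : x < 2 ^ m -> bits (x + 2 ^ m) = rcons (pad m (bits x)) true.
Proof.
rewrite /pad; elim: m x => [|m IH] x; first by case: x.
rewrite expnS => lt; case: (posnP x) => [->|x0].
  rewrite add0n mul2n -(add0n _.*2) (bits_double false) ?expn_gt0 //.
  by rewrite -[2 ^ m]add0n IH ?expn_gt0 // bits0 /= !subn0.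
have bx : odd x + x./2.*2 = x by exact: odd_double_half.
rewrite -{1}bx mul2n -addnA -doubleD bits_double; last by rewrite addn_gt0 expn_gt0 orbT.
rewrite IH; last by lia.
case: (posnP x./2) => [E|h0]; last by rewrite -[in RHS]bx bits_double.
have -> : x = 1 by lia.
by rewrite bits1 bits0 /= subn0 subn1.
Qed.

Lemma bits_ltn x : x < 2 ^ size (bits x).
Proof. by rewrite size_mkseq; exact: (up_logP x.+1). Qed.

Lemma sumn_encode xs : sumn xs < 2 ^ size (encode_nats xs).
Proof.
elim: xs => //= x xs IH; rewrite /encode_nats /= size_cat size_rcons size_map.
have := bits_ltn x; have := IH; rewrite -/(encode_nats xs) expnD expnS.
set a := 2 ^ size (bits x); set c := 2 ^ _ => h1 h2.
by nia.
Qed.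

Section Instance.
Variable x : kls_instance.
Let L := size (kls_encode x).

(** The sizes in this list are used with consecutive powers from
    2^(2L+2) on; big_vars repeats that first power with one more filler. *)
Definition sizes : seq nat := nseq L (2 ^ L) ++ kls_B x :: kls_size x.
Definition big_vars := gap_var L.*2.+1 (2 ^ L) :: gap_vars L.*2.+1 sizes.
Definition all_vars := gap_var L 0 :: big_vars.
Definition red_G := true + (kls_B x).*2 + 2 ^ (L.*2.+1 + size sizes).+1.
(** There are n = size sizes + 1 large variables, and the smallest closing
    tree has an odd number 2^(n+1) - 1 + 2 C of nodes, where C counts the light sets: so
    this even bound asks for C <= K. *)
Definition red_k := (kls_K x).*2 + 2 ^ (size sizes).+2.

Lemma enc_bounds : [/\ kls_K x < 2 ^ L, kls_B x + sumn (kls_size x) < 2 ^ L & 0 < L].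
Proof.
have := sumn_encode [:: kls_K x, kls_B x & kls_size x]; rewrite -/(kls_encode x) -/L /= => h.
split; [lia | lia |].
by move: h; case: L => //; have := kls_K_gt0 x; rewrite expn0; lia.
Qed.

Lemma all_vars_ok :
  [forall i, 1 <= (tnth (in_tuple all_vars) i).1 <= (tnth (in_tuple all_vars) i).2].
Proof.
apply/forallP=> i; have := mem_tnth i (in_tuple all_vars); move: (tnth _ i) => q.
have pos m z : 0 < (gap_var m z).1 <= (gap_var m z).2 by rewrite expn_gt0 /= leq_addr.
rewrite !inE => /or3P[/eqP -> //|/eqP -> //|/gap_vars_ge /andP[h ->]].
by rewrite andbT (leq_trans _ h) ?expn_gt0.
Qed.

Lemma ones_ok : [forall i, 0 < tnth (nseq_tuple (size all_vars) 1) i].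
Proof. by apply/forallP=> i; rewrite (tnth_nth 0) nth_nseq ltn_ord. Qed.

Lemma red_G_gt0 : 0 < red_G. Proof. by []. Qed.
Lemma red_k_gt0 : 0 < red_k. Proof. by rewrite addn_gt0 expn_gt0 orbT. Qed.

Definition reduction : gvb_instance := GVBInstance all_vars_ok red_G_gt0 red_k_gt0 ones_ok.

(** The growth needed for the weights: the L + 1 fillers and the extra variable
    contribute L + 2 times 2^(L+1), the true sizes less than once more, and all
    this must fit below the smallest power 2^(2L+2). *)
Lemma leq_add3_exp2 n : 0 < n -> n.+3 <= 2 ^ n.+1.
Proof.
case: n => // n _; elim: n => // n IH; rewrite expnS mul2n -addnn.
by move: IH; set a := 2 ^ _ => h; lia.
Qed.

(** Fillers never occur in a light set, and B, which is now one of the sizes,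
    occurs only in its singleton: hence one light set more than in the original
    instance. *)
Lemma light_sizes : light (map double (2 ^ L :: sizes)) (kls_B x).*2.+1 =
  (light (kls_size x) (kls_B x).+1).+1.
Proof.
have [_ hB L0] := enc_bounds.
rewrite (_ : _.*2.+1 = (kls_B x).+1.*2.-1) // light_double /sizes.
rewrite -[_ :: _]/((2 ^ L :: nseq L (2 ^ L)) ++ _) light_cat_heavy /=; last first.
  by rewrite all_nseq andbC; apply/andP; split; [apply/orP; right|]; lia.
rewrite subSnn light1 ?addn1 //.
apply/(all_tnthP); exact/forallP/(kls_size_gt0 x).
Qed.

Lemma reduction_correct : kls_answer x <-> ~ gvb_answer reduction.
Proof.
have [hK hB L0] := enc_bounds.
rewrite kls_answerE /gvb_answer /= /red_G /red_k addnC.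
have E := @closing_tree_iff (gap_var L 0) big_vars (2 ^ L.*2.+2)
  (2 ^ (L.*2.+1 + size sizes).+1) (true + (kls_B x).*2) ((kls_K x).*2 + 2 ^ (size sizes).+2).
have {}E := E _ _ _ _ _; rewrite E.
- rewrite /= spread_gap_vars size_gap_vars /spread addKn.
  have := light_sizes; rewrite /= => ->.
  move: (2 ^ _) (light _ _) => p c; split=> [h1 h2|/negP h]; lia.
- by rewrite /= expnS; lia.
- by rewrite /= addn0.
- move=> q; rewrite inE => /orP[/eqP -> /=|/gap_vars_ge //].
  by rewrite leqnn leq_addr.
- rewrite /= spread_gap_vars /spread addKn.
  rewrite (_ : sumn (map double sizes) = (sumn sizes).*2); last first.
    by elim: sizes => //= a s ->; rewrite doubleD.
  rewrite (_ : L.*2.+2 = L.+1 + L.+1); last by lia.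
  rewrite expnD /sizes sumn_cat sumn_nseq /=.
  have := leq_add3_exp2 L0; rewrite !expnS; move: (2 ^ L) hB => A hB hA.
  have : A * L.+3 <= A * (2 * A) by rewrite leq_mul2l hA orbT.
  by lia.
by rewrite /= sum_gap_vars.
Qed.
End Instance.

(** * Words of the reduced instance *)

(** The encoding of b + 2 x + 2^(m+1), where s is the binary notation of x. *)
Definition field (b : bool) m (s : seq bool) : word :=
  map Some (b :: rcons (pad m s) true) ++ [:: None].

Lemma encode_field (b : bool) m x :
  x < 2 ^ m -> encode_nat (b + x.*2 + 2 ^ m.+1) = field b m (bits x).
Proof.
move=> lt; rewrite expnS mul2n -addnA -doubleD /encode_nat -cats1.
by rewrite bits_double ?bits_pow // addn_gt0 expn_gt0 orbT.
Qed.

(** The encoding of a variable (2^(m+1), 2^(m+1) + 2 x) with multiplicity 1. *)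
Definition var_field m s : word :=
  field false m [::] ++ field false m s ++ [:: Some true; None].

Fixpoint var_fields m ss : word :=
  if ss is s :: ss' then var_field m s ++ var_fields m.+1 ss' else [::].

Definition triple (p : nat * nat) : seq nat := [:: p.1; p.2; 1].

Lemma encode_nats_cat s s' : encode_nats (s ++ s') = encode_nats s ++ encode_nats s'.
Proof. by rewrite /encode_nats map_cat flatten_cat. Qed.

Lemma encode_gap_var m x : x < 2 ^ m -> encode_nats (triple (gap_var m x)) = var_field m (bits x).
Proof.
move=> lt; rewrite /encode_nats /triple /gap_var /= [_ + x.*2]addnC.
have := @encode_field false m 0; rewrite add0n bits0 => -> //; last exact: expn_gt0.
by rewrite (encode_field false lt).
Qed.

Lemma encode_gap_vars m xs : all (fun x => x < 2 ^ m) xs ->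
  encode_nats (flatten (map triple (gap_vars m xs))) = var_fields m (map bits xs).
Proof.
elim: xs m => //= x xs IH m /andP[lt lts].
rewrite -[_ :: _ ]/(triple (gap_var m x) ++ _) encode_nats_cat encode_gap_var // IH //.
by apply: sub_all lts => y lty; rewrite expnS; lia.
Qed.

Lemma reduction_encode x (L := size (kls_encode x)) (S := sizes x) :
  gvb_encode (reduction x) =
  field true (L.*2.+1 + size S) (bits (kls_B x)) ++
  field false (size S).+1 (bits (kls_K x)) ++
  var_field L [::] ++ var_field L.*2.+1 (bits (2 ^ L)) ++ var_fields L.*2.+1 (map bits S).
Proof.
have [hK hB L0] := enc_bounds x; rewrite -/L in hK hB L0.
have up m n : m <= n -> 2 ^ m <= 2 ^ n by rewrite leq_exp2l.
have triples vs : [seq [:: z.1.1; z.1.2; z.2] | z <- zip vs (nseq (size vs) 1)] = map triple vs.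
  by elim: vs => //= p vs ->.
have -> : gvb_encode (reduction x) =
    encode_nats ([:: red_G x] ++ [:: red_k x] ++ flatten (map triple (all_vars x))).
  by rewrite -triples.
have E1 : flatten (map triple (all_vars x)) = triple (gap_var L 0) ++
   triple (gap_var L.*2.+1 (2 ^ L)) ++ flatten (map triple (gap_vars L.*2.+1 S)) by [].
rewrite E1 4!encode_nats_cat.
have -> : encode_nats [:: red_G x] = field true (L.*2.+1 + size S) (bits (kls_B x)).
  rewrite /encode_nats /= cats0 encode_field //.
  by apply: leq_ltn_trans (leq_addr _ _) (leq_trans hB (up _ _ _)); lia.
have -> : encode_nats [:: red_k x] = field false (size S).+1 (bits (kls_K x)).
  rewrite /encode_nats /= cats0 -[red_k x]/(false + _ + _) encode_field //.
  by apply: leq_trans hK (up _ _ _); rewrite /S /sizes size_cat size_nseq -/L; lia.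
have pow1 : 2 ^ L < 2 ^ L.*2.+1 by rewrite ltn_exp2l //; lia.
rewrite !encode_gap_var ?expn_gt0 // encode_gap_vars //.
rewrite /S /sizes all_cat all_nseq -/L pow1 orbT /=; apply/andP; split; first lia.
apply/allP=> y ys; have : y <= sumn (kls_size x) by rewrite (perm_sumn (perm_to_rem ys)) leq_addr.
by lia.
Qed.

(** * The Turing machine *)

(** Who is being written: the extra variable, the first filler (after which
    U does not grow, so that its power is used twice), one of the other
    fillers, or a variable made from a number of the input. *)
Variant mode := Slack | Seed | Filler | Item.

(** Measure copies the length of the input to U as a block of zeros.  A variable
    is written by the states from LeftStart to MultEnd: the left
    weight while the head of U runs to the left, the right weight while it runs back,
    then the multiplicity 1.  Extend appends as many zeros to U as there are
    input symbols, while the input head returns to the start; NextFiller, Return,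
    SkipK and NextItem drive the loops over fillers and numbers.  After rewinding
    all tapes, the states with a boolean copy K onto V (false), then B
    onto U (true): Fetch overwrites the leading zeros by the bits, Fill clears
    the rest and Top and Flush write the field backwards. *)
Variant state :=
  | Measure
  | LeftStart of mode | LeftBody of mode | LeftEnd of mode
  | RightStart of mode | RightBody of mode | RightEnd of mode
  | MultBit of mode | MultEnd of mode
  | Extend | NextFiller | Return | SkipK | NextItem
  | RewindIn | RewindU | RewindV | RewindOut
  | Fetch of bool | Fill of bool | Top of bool | Flush of bool
  | Done.

Definition mode_code m := match m with Slack => 0 | Seed => 1 | Filler => 2 | Item => 3 end.
Definition mode_decode k := match k with 0 => Slack | 1 => Seed | 2 => Filler | _ => Item end.

Definition state_code (q : state) : nat * nat :=
  match q with
  | Measure => (0, 0)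
  | LeftStart m => (1, mode_code m) | LeftBody m => (2, mode_code m)
  | LeftEnd m => (3, mode_code m) | RightStart m => (4, mode_code m)
  | RightBody m => (5, mode_code m) | RightEnd m => (6, mode_code m)
  | MultBit m => (7, mode_code m) | MultEnd m => (8, mode_code m)
  | Extend => (9, 0) | NextFiller => (10, 0) | Return => (11, 0)
  | SkipK => (12, 0) | NextItem => (13, 0)
  | RewindIn => (14, 0) | RewindU => (15, 0) | RewindV => (16, 0)
  | RewindOut => (17, 0)
  | Fetch b => (18, nat_of_bool b) | Fill b => (19, nat_of_bool b)
  | Top b => (20, nat_of_bool b) | Flush b => (21, nat_of_bool b)
  | Done => (22, 0)
  end.

Definition state_decode (c : nat * nat) : state :=
  let m := mode_decode c.2 in let b := c.2 == 1 in
  match c.1 with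
  | 0 => Measure
  | 1 => LeftStart m | 2 => LeftBody m | 3 => LeftEnd m
  | 4 => RightStart m | 5 => RightBody m | 6 => RightEnd m
  | 7 => MultBit m | 8 => MultEnd m
  | 9 => Extend | 10 => NextFiller | 11 => Return | 12 => SkipK | 13 => NextItem
  | 14 => RewindIn | 15 => RewindU | 16 => RewindV | 17 => RewindOut
  | 18 => Fetch b | 19 => Fill b | 20 => Top b | 21 => Flush b
  | _ => Done
  end.

Lemma state_codeK : cancel state_code state_decode.
Proof. by case=> // [] []. Qed.

HB.instance Definition _ := Countable.copy state (can_type state_codeK).

Definition all_states : seq state :=
  [seq c m | c <- [:: LeftStart; LeftBody; LeftEnd; RightStart; RightBody; RightEnd;
                   MultBit; MultEnd],
             m <- [:: Slack; Seed; Filler; Item]] ++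
  [seq c b | c <- [:: Fetch; Fill; Top; Flush], b <- [:: false; true]] ++
  [:: Measure; Extend; NextFiller; Return; SkipK; NextItem;
      RewindIn; RewindU; RewindV; RewindOut; Done].

Lemma all_states_axiom : Finite.axiom all_states.
Proof. by case=> // [] []. Qed.

HB.instance Definition _ := isFinite.Build state all_states_axiom.

Definition tcell := option (symbol + void).
Definition ttape := (seq tcell * seq tcell)%type.
Definition action := option (tcell * move).
Definition sym (s : symbol) : tcell := Some (inl s).
Definition bit (b : bool) : tcell := sym (Some b).
Definition hash : tcell := sym None.

(** The arguments a, u, v, o are the cells scanned on the input, U, V
    and output tapes.  After the extra variable has been written, a 1 is
    appended to U, which then holds the binary notation of the filler 2^L and is
    itself copied into the right weights of the fillers. *)
Definition delta (q : state) (a u v o : tcell) :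
    state * (action * action * action * action) :=
  let idle : action := None in
  let left (c : tcell) : action := Some (c, MoveLeft) in
  let right (c : tcell) : action := Some (c, MoveRight) in
  match q with
  | Measure => if a is None then (LeftStart Slack, (idle, idle, idle, idle))
               else (Measure, (right a, right (bit false), idle, idle))
  | LeftStart m => (LeftBody m, (idle, left u, idle, right (bit false)))
  | LeftBody m => if u is None then (LeftEnd m, (idle, right u, idle, right (bit true)))
                  else (LeftBody m, (idle, left u, idle, right (bit false)))
  | LeftEnd m => (RightStart m, (idle, idle, idle, right hash))
  | RightStart m => (RightBody m, (idle, idle, idle, right (bit false)))
  | RightBody m =>
    if u is None then (RightEnd m, (idle, idle, idle, right (bit true))) else
    let: (copied, x) := match m, a with
      | Slack, _ => (bit false, idle)
      | Item, Some (inl (Some _)) => (a, right a)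
      | Item, _ => (bit false, idle)
      | _, _ => (u, idle)
      end in
    (RightBody m, (x, right u, idle, right copied))
  | RightEnd m => (MultBit m, (idle, idle, idle, right hash))
  | MultBit m => (MultEnd m, (idle, idle, idle, right (bit true)))
  | MultEnd Slack => (Extend, (left a, right (bit true), idle, right hash))
  | MultEnd Seed => (NextFiller, (idle, idle, right (bit false), right hash))
  | MultEnd Filler => (NextFiller, (idle, right (bit false), right (bit false), right hash))
  | MultEnd Item => (NextItem, (right a, right (bit false), right (bit false), right hash))
  | Extend => if a is None then (LeftStart Seed, (right a, idle, idle, idle))
              else (Extend, (left a, right (bit false), idle, idle))
  | NextFiller => if a is None then (Return, (left a, idle, idle, idle))
                  else (LeftStart Filler, (right a, idle, idle, idle))
  | Return => if a is None then (SkipK, (right a, idle, idle, idle))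
              else (Return, (left a, idle, idle, idle))
  | SkipK => (if a is Some (inl (Some _)) then SkipK else NextItem, (right a, idle, idle, idle))
  | NextItem => if a is None then (RewindIn, (left a, left u, left v, left o))
                else (LeftStart Item, (idle, idle, idle, idle))
  | RewindIn => if a is None then (RewindU, (right a, idle, idle, idle))
                else (RewindIn, (left a, idle, idle, idle))
  | RewindU => if u is None then (RewindV, (idle, right u, idle, idle))
               else (RewindU, (idle, left u, idle, idle))
  | RewindV => if v is None then (RewindOut, (idle, idle, right v, idle))
               else (RewindV, (idle, idle, left v, idle))
  | RewindOut => if o is None then (Fetch false, (idle, idle, idle, idle))
                 else (RewindOut, (idle, idle, idle, left o))
  | Fetch b =>
    if a is Some (inl (Some _)) then
      (Fetch b, (right a, if b then right a else idle, if b then idle else right a, idle))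
    else (Fill b, (right a, idle, idle, idle))
  | Fill b =>
    if (if b then u else v) is None then
      (Top b, (idle, if b then left u else idle, if b then idle else left v, left hash))
    else (Fill b, (idle, if b then right (bit false) else idle,
                   if b then idle else right (bit false), idle))
  | Top b => (Flush b, (idle, idle, idle, left (bit true)))
  | Flush b =>
    let x := if b then u else v in
    if x is None then
      if b then (Done, (idle, idle, idle, Some (bit true, Stay)))
      else (Fetch true, (idle, idle, idle, left (bit false)))
    else (Flush b, (idle, if b then left u else idle, if b then idle else left v, left x))
  | Done => (Done, (idle, idle, idle, idle))
  end.

Definition tape_index : finType := (bool * bool)%type.

Definition select T (i : tape_index) (a u v o : T) : T :=
  match i with
  | (false, false) => a | (false, true) => u | (true, false) => v | (true, true) => o
  end.

Definition machine : tm := @TM state tape_index void Measure (pred1 Done)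
  (false, false) (true, true)
  (fun q f =>
     let: (q', (a, u, v, o)) :=
       delta q (f (false, false)) (f (false, true)) (f (true, false)) (f (true, true)) in
     (q', [ffun i => odflt (f i, Stay) (select i a u v o)])).

(** * Simulation on normalized tapes *)

(** Adding a blank to an empty side changes nothing: thus tapes that differ
    only by blanks at their ends get one representation, and the tape
    contents in the lemmas on runs are plain lists. *)
Definition bcons (c : tcell) (s : seq tcell) : seq tcell :=
  if (c, s) is (None, [::]) then [::] else c :: s.

(** Moving the head one cell to the left. *)
Definition pull (t : ttape) : ttape := (behead t.1, bcons (head None t.1) t.2).

(** An action None leaves the tape as it is, whereas the machine rewrites the
    scanned cell, possibly making an implicit blank explicit; same_tape
    absorbs the difference. *)
Definition act (t : ttape) (x : action) : ttape :=
  match x with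
  | None => t
  | Some (c, MoveLeft) => pull (t.1, bcons c (behead t.2))
  | Some (c, MoveRight) => (bcons c t.1, behead t.2)
  | Some (c, Stay) => (t.1, bcons c (behead t.2))
  end.

Definition conf := (state * ttape * ttape * ttape * ttape)%type.

Definition cstep (c : conf) : conf :=
  let: (q, a, u, v, o) := c in
  let: (q', (x, y, z, w)) :=
    delta q (head None a.2) (head None u.2) (head None v.2) (head None o.2) in
  (q', act a x, act u y, act v z, act o w).

Definition same_cells (s s' : seq tcell) := forall i, nth None s i = nth None s' i.
Definition same_tape (t t' : ttape) := same_cells t.1 t'.1 /\ same_cells t.2 t'.2.

Lemma same_bcons c s s' : same_cells s s' -> same_cells (c :: s) (bcons c s').
Proof.
move=> h [|i]; first by case: c; case: s' h.
by rewrite /= h /bcons; case: c s' {h} => [?|] [] //=; rewrite ?nth_nil.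
Qed.

Lemma same_behead s s' : same_cells s s' -> same_cells (behead s) (behead s').
Proof. by move=> h i; rewrite !nth_behead h. Qed.

Lemma same_head s s' : same_cells s s' -> head None s = head None s'.
Proof. by move=> h; rewrite -!nth0 h. Qed.

Lemma same_act t t' x : same_tape t t' ->
  same_tape (@write_move machine t (odflt (scan (M := machine) t, Stay) x)) (act t' x).
Proof.
case=> h1 h2; case: x => [[c []]|] /=.
- split; first exact: same_behead.
  by rewrite (same_head h1); do 2!apply: same_bcons; exact: same_behead.
- by split; [apply: same_bcons | apply: same_behead].
- by split=> //; apply: same_bcons; apply: same_behead.
split=> // -[|i]; rewrite -h2 /=; first by rewrite /scan nth0.
by rewrite nth_behead.
Qed.

Definition models (c : config machine) (c' : conf) :=
  let: (q, a, u, v, o) := c' in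
  c.1 = q /\ forall i, same_tape (c.2 i) (select i a u v o).

Lemma models_step c c' : models c c' -> models (step c) (cstep c').
Proof.
case: c => q f; case: c' => [[[[q' a] u] v] o] [/= -> h] {q}.
rewrite /step /=; case: eqP => [->|_]; first by [].
rewrite !ffunE /scan.
have [_ /same_head /= ->] := h (false, false).
have [_ /same_head /= ->] := h (false, true).
have [_ /same_head /= ->] := h (true, false).
have [_ /same_head /= ->] := h (true, true).
case: (delta _ _ _ _ _) => [q'' [[[x y] z] w]]; split=> //= i.
rewrite !ffunE; have := h i; case: i => [[] []] /=; exact: same_act.
Qed.

(** Bounds on the time suffice, since Done is stable. *)
Definition reach n (c c' : conf) := exists2 t, t <= n & iter t cstep c = c'.

Lemma reach_refl n c : reach n c c. Proof. by exists 0. Qed.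

Lemma reach_step n c c' : reach n (cstep c) c' -> reach n.+1 c c'.
Proof. by case=> t le E; exists t.+1; rewrite ?iterSr. Qed.

Lemma reach_trans m n c c' c'' : reach m c c' -> reach n c' c'' -> reach (m + n) c c''.
Proof.
case=> t le <- [t' le' <-]; exists (t' + t); last by rewrite iterD.
by rewrite addnC leq_add.
Qed.

Lemma reach_le m n c c' : m <= n -> reach m c c' -> reach n c c'.
Proof. by move=> le [t le' <-]; exists t => //; apply: leq_trans le. Qed.

Lemma done_stable n a u v o : iter n cstep (Done, a, u, v, o) = (Done, a, u, v, o).
Proof. by elim: n => //= n ->. Qed.

(** The output is w' as soon as the normalized output tape is w' from the head
    on: the first blank of the actual tape is at position size w'. *)
Lemma machine_computes n w w' a u v l :
    reach n (Measure, ([::], map sym w), ([::], [::]), ([::], [::]), ([::], [::]))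
            (Done, a, u, v, (l, map sym w')) ->
  tm_computes_within machine w w' n.
Proof.
case=> t le E; rewrite /tm_computes_within /=.
have: models (iter n (@step machine) (init_config machine w)) (Done, a, u, v, (l, map sym w')).
  rewrite -(done_stable (n - t)) -E -iterD subnK //.
  elim: n {le} => [|n IH]; last exact: models_step.
  by split=> // i; rewrite ffunE; case: i => [[] []].
case: (iter n _ _) => q f [/= -> h]; split=> //; rewrite /output_cells /=.
have {h} [_ /= h] := h (true, true); set r := (f _).2 in h *.
have lt i : i < size w' -> nth None r i = Some (inl (nth None w' i)).
  by move=> lti; rewrite h (nth_map None).
have -> : find (pred1 None) r = size w'.
  have blank : nth None r (size w') = None by rewrite h nth_default // size_map.
  have nf i : i < size w' -> ~~ pred1 None (nth None r i) by move/lt ->.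
  apply/eqP; rewrite eqn_leq; apply/andP; split; rewrite leqNgt; apply/negP => l'.
    by have := before_find None l'; rewrite /= blank.
  have lt' := nf _ l'; case: (ltnP (find (pred1 None) r) (size r)) => lr.
    by move: lt'; rewrite nth_find ?has_find.
  by move: lt'; rewrite nth_default.
have sr : size w' <= size r.
  rewrite leqNgt; apply/negP => l'; have := lt _ l'; by rewrite nth_default.
apply: (@eq_from_nth _ None) => [|i]; rewrite size_takel ?size_map // => li.
by rewrite nth_take // (nth_map None) // lt.
Qed.

Arguments field : simpl never.
Arguments var_field : simpl never.

(** * Runs of the loops *)

Lemma head_blank r : head None (bcons None r) = None. Proof. by case: r. Qed.
Lemma behead_blank r : behead (bcons None r) = r. Proof. by case: r. Qed.

Lemma catrev_cat T (s1 s2 t : seq T) : catrev (s1 ++ s2) t = catrev s2 (catrev s1 t).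
Proof. by elim: s1 t => //= x s1 IH t. Qed.

Lemma catrev_nseq T n (c : T) t : catrev (nseq n c) t = nseq n c ++ t.
Proof. by rewrite catrevE rev_nseq. Qed.

Lemma catrev_rev T (s t : seq T) : catrev (rev s) t = s ++ t.
Proof. by rewrite catrevE revK. Qed.

Lemma nseq_cons T n (c : T) t : nseq n c ++ c :: t = c :: nseq n c ++ t.
Proof. by elim: n => //= n ->. Qed.

(** The block r with the head on the blank just before it. *)
Definition before (r : seq tcell) : ttape := ([::], bcons None r).

(** In the lemmas below, the left part of a tape is listed from the head
    outwards, so that text written so far appears reversed, and appending text is
    catrev. *)
Lemma measure_run w p u v o :
  reach (size w).+1 (Measure, (p, map sym w), (u, [::]), v, o)
    (LeftStart Slack, (catrev (map sym w) p, [::]), (nseq (size w) (bit false) ++ u, [::]), v, o).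
Proof.
elim: w p u => [|s w IH] p u; apply: reach_step; first exact: reach_refl.
by have := IH (sym s :: p) (bit false :: u); rewrite /= nseq_cons.
Qed.

Lemma left_run m a l r v o :
  reach (size l).+1 (LeftBody m, a, pull (map bit l, r), v, (o, [::]))
    (LeftEnd m, a, ([::], catrev (map bit l) r), v,
     (bit true :: nseq (size l) (bit false) ++ o, [::])).
Proof.
elim: l r o => [|b l IH] r o; apply: reach_step; rewrite /= ?head_blank /= ?behead_blank.
  exact: reach_refl.
by have := IH (bit b :: r) (bit false :: o); rewrite /= nseq_cons.
Qed.

Definition right_bits m (s : seq bool) := if m is Slack then nseq (size s) false else s.

Lemma right_run m a l s v o : m <> Item ->
  reach (size s).+1 (RightBody m, a, (l, map bit s), v, (o, [::]))
    (RightEnd m, a, (catrev (map bit s) l, [::]), v,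
     (bit true :: catrev (map bit (right_bits m s)) o, [::])).
Proof.
move=> mI; elim: s l o => [|b s IH] l o; apply: reach_step.
  by case: m mI => //= _; exact: reach_refl.
by case: m mI IH => // _ IH; exact: IH.
Qed.

(** The input head stops at the separator after x, and zeros are written until
    U is exhausted: this is the padding of x to the length of U. *)
Lemma right_item_run p x w l s v o : size x <= size s ->
  reach (size s).+1 (RightBody Item, (p, map bit x ++ hash :: w), (l, map bit s), v, (o, [::]))
    (RightEnd Item, (catrev (map bit x) p, hash :: w), (catrev (map bit s) l, [::]), v,
     (bit true :: catrev (map bit (pad (size s) x)) o, [::])).
Proof.
elim: s x p l o => [|b s IH] [|c x] p l o //= le; apply: reach_step => /=; try exact: reach_refl.
  by have := IH [::] p (bit b :: l) (bit false :: o) (leq0n _); rewrite /pad /= !subn0.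
by have := IH x (bit c :: p) (bit b :: l) (bit c :: o) le.
Qed.

Lemma map_sym_field b m s :
  map sym (field b m s) = bit b :: map bit (pad m s) ++ [:: bit true; hash].
Proof.
by rewrite /field /= map_cat -map_comp map_rcons -cats1 -catA.
Qed.

(** The final separator is left to MultEnd, whose effect on the tapes U and V
    depends on the mode; o' is the output without it. *)
Lemma emit_run m a a' y z v o o' :
    catrev (map sym (var_field (size y) z)) o = hash :: o' ->
    (forall l, reach (size y).+1 (RightBody m, a, ([::], map bit y), v, (l, [::]))
      (RightEnd m, a', (rev (map bit y), [::]), v,
       (bit true :: catrev (map bit (pad (size y) z)) l, [::]))) ->
  reach (2 * size y + 7) (LeftStart m, a, (rev (map bit y), [::]), v, (o, [::]))
    (MultEnd m, a', (rev (map bit y), [::]), v, (o', [::])).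
Proof.
move=> + hr; rewrite /var_field map_cat map_sym_field map_cat map_sym_field.
rewrite !catrev_cat [catrev (_ :: _) _]/= /= => -[<-].
have -> : 2 * size y + 7 = ((size y).+1 + ((size y).+1 + 2).+2).+1 by lia.
apply: reach_step; rewrite /= -map_rev.
rewrite !catrev_cat /=.
apply: reach_trans; first by rewrite -(size_rev y); exact: left_run.
do 2!apply: reach_step => /=.
rewrite size_rev map_rev catrev_rev cats0.
apply: reach_trans; first exact: hr.
do 2!apply: reach_step => /=.
by rewrite /= /pad /= subn0 map_nseq catrev_nseq -map_rev; exact: reach_refl.
Qed.

Lemma emit_plain_run m a y v o o' : m <> Item ->
    catrev (map sym (var_field (size y) (right_bits m y))) o = hash :: o' ->
  reach (2 * size y + 7) (LeftStart m, a, (rev (map bit y), [::]), v, (o, [::]))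
    (MultEnd m, a, (rev (map bit y), [::]), v, (o', [::])).
Proof.
move=> mI Eo; have E : size (right_bits m y) = size y by case: (m) mI => //= _; rewrite size_nseq.
apply: emit_run Eo _ => l.
by rewrite /pad E subnn cats0; apply: right_run.
Qed.

Lemma var_field_tail m s o :
  exists o', catrev (map sym (var_field m s)) o = hash :: o'.
Proof. by rewrite /var_field catA map_cat catrev_cat; eexists. Qed.

Lemma var_fields_cons m s ss o o' :
    catrev (map sym (var_field m s)) o = hash :: o' ->
  catrev (map sym (var_fields m (s :: ss))) o =
  catrev (map sym (var_fields m.+1 ss)) (hash :: o').
Proof. by move=> <-; rewrite -catrev_cat -map_cat. Qed.

Lemma size_pad m s : size s <= m -> size (pad m s) = m.
Proof. by move=> le; rewrite size_cat size_nseq subnKC. Qed.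

Lemma pad_pad m n s : size s <= m -> m <= n -> pad n (pad m s) = pad n s.
Proof.
move=> le le'; rewrite {1}/pad size_pad // /pad -catA -nseqD; congr (_ ++ nseq _ _); lia.
Qed.

Lemma rcons_pad m s : size s <= m -> rcons (pad m s) false = pad m.+1 s.
Proof.
by move=> le; rewrite /pad rcons_cat subSn //; congr (_ ++ _); elim: (m - _) => //= n ->.
Qed.

Lemma var_field_pad m s : size s <= m -> var_field m (pad m s) = var_field m s.
Proof. by move=> le; rewrite /var_field /field pad_pad. Qed.

Lemma rev_bit_rcons y b : bcons (bit b) (rev (map bit y)) = rev (map bit (rcons y b)).
Proof. by rewrite map_rcons rev_rcons. Qed.

(** The contents of U are s padded with zeros, and remain so as U grows; this is
    why the fillers get the same value at all lengths. *)
Lemma fillers_run w p m s c o : size s <= m ->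
  reach (size w * (2 * (m + size w) + 9)).+1
    (NextFiller, (p, map sym w), (rev (map bit (pad m s)), [::]),
     (nseq c (bit false), [::]), (o, [::]))
    (Return, pull (catrev (map sym w) p, [::]), (rev (map bit (pad (m + size w) s)), [::]),
     (nseq (c + size w) (bit false), [::]),
     (catrev (map sym (var_fields m (nseq (size w) s))) o, [::])).
Proof.
elim: w p m c o => [|x w IH] p m c o le.
  by apply: reach_step; rewrite !addn0; exact: reach_refl.
apply: (@reach_le (2 * m + 7 + (size w * (2 * (m.+1 + size w) + 9)).+1.+1).+1).
  by rewrite /= mulSn; nia.
have [o' Eo] := var_field_tail m s o.
rewrite (_ : nseq (size (x :: w)) s = s :: nseq (size w) s) // (var_fields_cons _ Eo).
apply: reach_step => /=; apply: reach_trans.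
  have := @emit_plain_run Filler (sym x :: p, map sym w) (pad m s) (nseq c (bit false), [::]) o o'.
  by rewrite size_pad // var_field_pad //; exact.
apply: reach_step => /=.
rewrite rev_bit_rcons rcons_pad // -(addSnnS m) -(addSnnS c).
exact: (IH (sym x :: p) m.+1 c.+1 (hash :: o') (leqW le)).
Qed.

Lemma next_item_step a u v o : head None a.2 ->
  cstep (NextItem, a, u, v, o) = (LeftStart Item, a, u, v, o).
Proof. by rewrite /cstep /=; case: (head _ _). Qed.

Lemma map_sym_encode x xs :
  map sym (encode_nats (x :: xs)) = map bit (bits x) ++ hash :: map sym (encode_nats xs).
Proof. by rewrite /encode_nats /= /encode_nat -cats1 !map_cat -map_comp -catA. Qed.

Lemma items_run xs p m s c o : size s <= m -> all (fun x => size (bits x) <= m) xs ->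
  reach (size xs * (2 * (m + size xs) + 9)).+1
    (NextItem, (p, map sym (encode_nats xs)), (rev (map bit (pad m s)), [::]),
     (nseq c (bit false), [::]), (o, [::]))
    (RewindIn, pull (catrev (map sym (encode_nats xs)) p, [::]),
     pull (rev (map bit (pad (m + size xs) s)), [::]),
     pull (nseq (c + size xs) (bit false), [::]),
     pull (catrev (map sym (var_fields m (map bits xs))) o, [::])).
Proof.
elim: xs p m c o => [|x xs IH] p m c o le.
  by move=> _; apply: reach_step; rewrite !addn0; exact: reach_refl.
case/andP=> lex lexs.
rewrite map_sym_encode catrev_cat [catrev (hash :: _) _]/=.
apply: (@reach_le (2 * m + 7 + (size xs * (2 * (m.+1 + size xs) + 9)).+1.+1).+1).
  by rewrite /= mulSn; nia.
apply: reach_step; rewrite next_item_step; last by case: (bits x).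
have szy := size_pad le; have [o' Eo] := var_field_tail m (bits x) o.
rewrite [map bits (x :: xs)]/= (var_fields_cons _ Eo).
apply: reach_trans.
  have := @emit_run Item (p, map bit (bits x) ++ hash :: map sym (encode_nats xs))
    (catrev (map bit (bits x)) p, hash :: map sym (encode_nats xs)) (pad m s) (bits x)
    (nseq c (bit false), [::]) o o'.
  rewrite szy; apply=> // l; rewrite -{1}szy; have := right_item_run.
  move=> /(_ p (bits x) (map sym (encode_nats xs)) [::] (pad m s)); rewrite szy.
  by apply.
apply: reach_step => /=.
rewrite rev_bit_rcons rcons_pad // -(addSnnS m) -(addSnnS c).
apply: (IH _ m.+1 c.+1 (hash :: o') (leqW le)).
by apply: sub_all lexs => i; exact: leqW.
Qed.

Lemma extend_run l r u v o :
  reach (size l).+1 (Extend, pull (map sym l, r), (u, [::]), v, o)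
    (LeftStart Seed, ([::], catrev (map sym l) r), (nseq (size l) (bit false) ++ u, [::]), v, o).
Proof.
elim: l r u => [|s l IH] r u; apply: reach_step; rewrite /= ?head_blank /= ?behead_blank.
  exact: reach_refl.
by have := IH (sym s :: r) (bit false :: u); rewrite /= nseq_cons.
Qed.

Lemma return_run l r u v o :
  reach (size l).+1 (Return, pull (map sym l, r), u, v, o)
    (SkipK, ([::], catrev (map sym l) r), u, v, o).
Proof.
elim: l r => [|s l IH] r; apply: reach_step; rewrite /= ?head_blank /= ?behead_blank.
  exact: reach_refl.
exact: (IH (sym s :: r)).
Qed.

Lemma rewind_in_run l r u v o :
  reach (size l).+1 (RewindIn, pull (map sym l, r), u, v, o)
    (RewindU, ([::], catrev (map sym l) r), u, v, o).
Proof.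
elim: l r => [|s l IH] r; apply: reach_step; rewrite /= ?head_blank /= ?behead_blank.
  exact: reach_refl.
exact: (IH (sym s :: r)).
Qed.

Lemma rewind_u_run a l r v o :
  reach (size l).+1 (RewindU, a, pull (map sym l, r), v, o)
    (RewindV, a, ([::], catrev (map sym l) r), v, o).
Proof.
elim: l r => [|s l IH] r; apply: reach_step; rewrite /= ?head_blank /= ?behead_blank.
  exact: reach_refl.
exact: (IH (sym s :: r)).
Qed.

Lemma rewind_v_run a u l r o :
  reach (size l).+1 (RewindV, a, u, pull (map sym l, r), o)
    (RewindOut, a, u, ([::], catrev (map sym l) r), o).
Proof.
elim: l r => [|s l IH] r; apply: reach_step; rewrite /= ?head_blank /= ?behead_blank.
  exact: reach_refl.
exact: (IH (sym s :: r)).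
Qed.

Lemma rewind_out_run a u v l r :
  reach (size l).+1 (RewindOut, a, u, v, pull (map sym l, r))
    (Fetch false, a, u, v, before (catrev (map sym l) r)).
Proof.
elim: l r => [|s l IH] r; apply: reach_step; rewrite /= ?head_blank /= ?behead_blank.
  exact: reach_refl.
exact: (IH (sym s :: r)).
Qed.

Lemma skip_run p x w u v o :
  reach (size x).+1 (SkipK, (p, map bit x ++ hash :: w), u, v, o)
    (NextItem, (hash :: catrev (map bit x) p, w), u, v, o).
Proof.
elim: x p => [|b x IH] p; apply: reach_step; first exact: reach_refl.
exact: IH.
Qed.

(** The tape t that is being filled is U when b is true and V when b is false; e
    is the other one of the two. *)
Definition dconf q a (b : bool) t e o : conf :=
  (q, a, if b then t else e, if b then e else t, o).

Lemma fetch_run b p x w l s e o : size x <= size s ->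
  reach (size x).+1 (dconf (Fetch b) (p, map bit x ++ hash :: w) b (l, map bit s) e o)
    (dconf (Fill b) (hash :: catrev (map bit x) p, w) b
       (catrev (map bit x) l, map bit (drop (size x) s)) e o).
Proof.
elim: x p l s => [|c x IH] p l s.
  by move=> _; apply: reach_step; rewrite drop0; case: b; exact: reach_refl.
case: s => // d s le; apply: reach_step.
by have := IH (bit c :: p) (bit c :: l) s le; case: b {IH}.
Qed.

Lemma fill_run b a l s e r :
  reach (size s).+1 (dconf (Fill b) a b (l, map bit s) e (before r))
    (dconf (Top b) a b (pull (nseq (size s) (bit false) ++ l, [::])) e (before (hash :: r))).
Proof.
elim: s l => [|c s IH] l; apply: reach_step.
  by rewrite /before -{2}(behead_blank r); case: b; exact: reach_refl.
by have := IH (bit false :: l); rewrite nseq_cons; case: b {IH}.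
Qed.

(** After the field of K the output head moves on to the left, to make room for
    the field of G; after the latter it stays on the first cell. *)
Definition flushed b a t e r : conf :=
  if b then (Done, a, t, e, ([::], r)) else dconf (Fetch true) a true e t (before r).

Lemma flush_run b a l t e r :
  reach (size l).+1 (dconf (Flush b) a b (pull (map bit l, t)) e (before r))
    (flushed b a (before (catrev (map bit l) t)) e (bit b :: catrev (map bit l) r)).
Proof.
elim: l t r => [|c l IH] t r; apply: reach_step.
  rewrite /before -{2}(behead_blank r).
  by case: b; rewrite /= ?head_blank; exact: reach_refl.
have := IH (bit c :: t) (bit c :: r).
by case: b {IH} => h; rewrite /= ?behead_blank; exact: h.
Qed.

Lemma put_run b p x w s e r : size x <= size s ->
  exists t, reach (2 * size s + size x + 4)
    (dconf (Fetch b) (p, map bit x ++ hash :: w) b ([::], map bit s) e (before r))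
    (flushed b (hash :: catrev (map bit x) p, w) t e (map sym (field b (size s) x) ++ r)).
Proof.
move=> le; eexists.
apply: (@reach_le ((size x).+1 + ((size (drop (size x) s)).+1 + (size s).+2))).
  by rewrite size_drop; lia.
apply: reach_trans; first exact: fetch_run.
apply: reach_trans; first exact: fill_run.
have E : nseq (size (drop (size x) s)) (bit false) ++ catrev (map bit x) [::] =
   map bit (rev (pad (size s) x)).
  by rewrite /pad rev_cat rev_nseq map_cat map_nseq map_rev size_drop.
rewrite E map_sym_field.
apply: reach_step.
have -> : (size s).+1 = (size (rev (pad (size s) x))).+1 by rewrite size_rev size_pad.
have := @flush_run b (hash :: catrev (map bit x) p, w) (rev (pad (size s) x)) [::] e
  (bit true :: hash :: r).
rewrite !map_rev !catrev_rev /= -catA /=.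
move=> h; exact: h.
Qed.

(** * The complete run *)

Lemma size_var_field m s : size s <= m -> size (var_field m s) = 2 * m + 8.
Proof.
move=> le; rewrite /var_field /field !size_cat !size_map /= !size_rcons !size_pad //=.
by lia.
Qed.

Lemma size_var_fields m ss : all (fun s => size s <= m) ss ->
  size (var_fields m ss) <= size ss * (2 * (m + size ss) + 8).
Proof.
elim: ss m => [//|s ss IH] m /andP[le les].
rewrite [size (var_fields _ _)](size_cat (var_field m s)) size_var_field //.
have := IH m.+1; rewrite (sub_all _ les) => [/(_ isT) h|t /leqW //].
have -> : m + size (s :: ss) = m.+1 + size ss by rewrite /= addnS.
rewrite [size (s :: ss)]/= [X in _ <= X]mulSn.
by apply: leq_add; [lia | exact: h].
Qed.

Lemma bits_pow2 m : bits (2 ^ m) = rcons (nseq m false) true.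
Proof. by have := @bits_pow m 0; rewrite add0n bits0 /pad subn0 expn_gt0 => ->. Qed.

Lemma reach_start c n c' c'' : cstep c = c' -> reach n c' c'' -> reach n.+1 c c''.
Proof. by move=> <-; exact: reach_step. Qed.

Lemma catrev_sym w : catrev (map sym w) [::] = map sym (rev w).
Proof. by rewrite map_rev. Qed.

Lemma catrev_sym_rev w : catrev (map sym (rev w)) [::] = map sym w.
Proof. by rewrite map_rev catrev_rev cats0. Qed.

Lemma map_sym_bits s : map bit s = map sym (map Some s).
Proof. by rewrite -map_comp. Qed.

Section Run.
Variables (K B : nat) (ss : seq nat).
Let xs := B :: ss.
Let w := encode_nats (K :: xs).
Let L := size w.
Let D := bits (2 ^ L).

Lemma size_bits_encode x ys : x \in ys -> size (bits x) <= size (encode_nats ys).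
Proof.
elim: ys => //= y ys IH; rewrite inE /encode_nats /= size_cat size_rcons size_map.
by case/orP=> [/eqP -> | /IH h]; [rewrite ltnW ?ltn_addr | exact: leq_trans h (leq_addl _ _)].
Qed.

Lemma size_encode_nats ys : size ys <= size (encode_nats ys).
Proof.
elim: ys => //= y ys IH; rewrite /encode_nats /= size_cat size_rcons.
by rewrite addSn ltnS (leq_trans IH) ?leq_addl.
Qed.

Definition vars_word := var_field L [::] ++ var_field L.*2.+1 D ++
  var_fields L.*2.+1 (nseq L D) ++ var_fields (L.*2.+1 + L) (map bits xs).

(** The quadratic bound: at most 2 L + 1 variables are written, each in
    time linear in the length of U, which stays below 4 L + 2. *)
Lemma vars_run : reach (100 * (L * L) + 100)
  (Measure, ([::], map sym w), ([::], [::]), ([::], [::]), ([::], [::]))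
  (RewindIn, pull (map sym (rev w), [::]),
   pull (rev (map bit (pad (L.*2.+1 + L + size xs) D)), [::]),
   pull (nseq (1 + L + size xs) (bit false), [::]), pull (map sym (rev vars_word), [::])).
Proof.
have hx x : x \in K :: xs -> size (bits x) <= L by exact: size_bits_encode.
have hK : size (bits K) <= L by apply: hx; rewrite mem_head.
have sD : size D = L.+1 by rewrite /D bits_pow2 size_rcons size_nseq.
have hn : size xs < L by exact: size_encode_nats (K :: xs).
set n := size xs in hn *.
have leD : size D <= L.*2.+1 by rewrite sD; lia.
have EW : map sym (rev vars_word) =
    catrev (map sym (var_fields (L.*2.+1 + L) (map bits xs)))
      (catrev (map sym (var_fields L.*2.+1 (nseq L D)))
        (catrev (map sym (var_field L.*2.+1 D)) (catrev (map sym (var_field L [::])) [::]))).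
  rewrite -catrev_sym /vars_word (map_cat _ (var_field L _)) catrev_cat.
  by rewrite (map_cat _ (var_field _ D)) catrev_cat (map_cat _ (var_fields _ _)) catrev_cat.
have EI : map sym (rev w) =
    catrev (map sym (encode_nats xs)) (hash :: catrev (map bit (bits K)) [::]).
  by rewrite -catrev_sym /w map_sym_encode catrev_cat.
rewrite EW EI.
apply: (@reach_le (L.+1 + (2 * L + 7 + (L.+1 + (2 * L.*2.+1 + 7 +
  ((L * (2 * (L.*2.+1 + L) + 9)).+1 + (L.+1 + ((size (bits K)).+1 +
   (n * (2 * (L.*2.+1 + L + n) + 9)).+1))).+1)).+1))).
  by nia.
apply: reach_trans; first exact: measure_run.
rewrite catrev_sym cats0.
have [o1 E1] := var_field_tail L [::] [::].
have pad0 : pad L [::] = nseq L false by rewrite /pad subn0.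
have -> : nseq L (bit false) = rev (map bit (pad L [::])) by rewrite pad0 map_nseq rev_nseq.
have sp : size (pad L [::]) = L by rewrite size_pad.
apply: reach_trans.
  have := @emit_plain_run Slack (map sym (rev w), [::]) (pad L [::]) ([::], [::]) [::] o1.
  by rewrite [right_bits _ _]/= sp -pad0 var_field_pad //; exact.
apply: (@reach_start _ _ (Extend, pull (map sym (rev w), [::]),
    (rev (map bit (rcons (pad L [::]) true)), [::]), ([::], [::]), (hash :: o1, [::]))).
  by rewrite -rev_bit_rcons.
rewrite -E1; apply: reach_trans.
  by apply: (reach_le _ (@extend_run _ _ _ _ _)); rewrite size_rev.
rewrite catrev_sym_rev size_rev -/L.
have padD : pad L.*2.+1 D = rcons (pad L [::]) true ++ nseq L false.
  by rewrite {1}/pad sD pad0 /D bits_pow2; congr (_ ++ nseq _ _); lia.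
have -> : nseq L (bit false) ++ rev (map bit (rcons (pad L [::]) true)) =
    rev (map bit (pad L.*2.+1 D)).
  by rewrite padD map_cat rev_cat map_nseq rev_nseq.
have [o2 E2] := var_field_tail L.*2.+1 D (catrev (map sym (var_field L [::])) [::]).
apply: reach_trans.
  have := @emit_plain_run Seed ([::], map sym w) (pad L.*2.+1 D) ([::], [::])
    (catrev (map sym (var_field L [::])) [::]) o2.
  by rewrite [right_bits _ _]/= size_pad // var_field_pad //; exact.
apply: (@reach_start _ _ (NextFiller, ([::], map sym w),
  (rev (map bit (pad L.*2.+1 D)), [::]), (nseq 1 (bit false), [::]), (hash :: o2, [::]))) => //.
rewrite -E2; apply: reach_trans; first exact: fillers_run.
rewrite catrev_sym -/L; apply: reach_trans.
  by apply: (reach_le _ (@return_run _ _ _ _ _)); rewrite size_rev.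
rewrite catrev_sym_rev /w map_sym_encode.
apply: reach_trans; first exact: skip_run.
apply: items_run.
  by apply: leq_trans leD (leq_addr _ _).
apply/allP=> x xxs; apply: (@leq_trans L); last by lia.
by apply: hx; rewrite inE xxs orbT.
Qed.

Definition result_word :=
  field true (L.*2.+1 + L + size xs) (bits B) ++
  field false (1 + L + size xs) (bits K) ++ vars_word.

Lemma size_vars_word : size vars_word <= 100 * (L * L) + 100.
Proof.
have hx x : x \in K :: xs -> size (bits x) <= L by exact: size_bits_encode.
have sD : size D = L.+1 by rewrite /D bits_pow2 size_rcons size_nseq.
have hn : size xs < L by exact: size_encode_nats (K :: xs).
have lD : size D <= L.*2.+1 by rewrite sD; lia.
have h1 := @size_var_fields L.*2.+1 (nseq L D).
have h2 := @size_var_fields (L.*2.+1 + L) (map bits xs).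
rewrite /vars_word size_cat (size_cat (var_field _ _)) (size_cat (var_fields _ _)).
rewrite !size_var_field //.
rewrite all_nseq lD orbT size_nseq in h1; have {}h1 := h1 isT.
have bxs : all (fun s => size s <= L.*2.+1 + L) (map bits xs).
  rewrite all_map; apply/allP=> x xxs; apply: (@leq_trans L); last by lia.
  by apply: hx; rewrite inE xxs orbT.
have {h2} := h2 bxs; rewrite size_map => h2.
by move: (size xs) hn h1 h2 => n; nia.
Qed.

Lemma full_run : exists a u v, reach (1000 * L ^ 2 + 1000)
  (Measure, ([::], map sym w), ([::], [::]), ([::], [::]), ([::], [::]))
  (Done, a, u, v, ([::], map sym result_word)).
Proof.
have hx x : x \in K :: xs -> size (bits x) <= L by exact: size_bits_encode.
have hK : size (bits K) <= L by apply: hx; rewrite mem_head.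
have hB : size (bits B) <= L by apply: hx; rewrite inE mem_head orbT.
have hn : size xs < L by exact: size_encode_nats (K :: xs).
have hW := size_vars_word.
have sD : size D = L.+1 by rewrite /D bits_pow2 size_rcons size_nseq.
have vr := vars_run.
set n := 1 + L + size xs in vr *; set m := L.*2.+1 + L + size xs in vr *.
have hKn : size (bits K) <= size (nseq n false) by rewrite size_nseq; lia.
have sm : size (pad m D) = m by rewrite size_pad // sD; lia.
have hBm : size (bits B) <= size (pad m D) by rewrite sm; lia.
have [t1 r1] := @put_run false [::] (bits K) (map sym (encode_nats xs)) (nseq n false)
  ([::], map bit (pad m D)) (map sym vars_word) hKn.
have [t2 r2] := @put_run true (hash :: catrev (map bit (bits K)) [::]) (bits B)
  (map sym (encode_nats ss)) (pad m D) t1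
  (map sym (field false n (bits K)) ++ map sym vars_word) hBm.
eexists _, _, _.
apply: (@reach_le (100 * (L * L) + 100 + (L.+1 + (m.+1 + (n.+1 + ((size vars_word).+1 +
   ((2 * n + size (bits K) + 4) + (2 * m + size (bits B) + 4)))))))).
  by rewrite /n /m -mulnn; nia.
apply: reach_trans; first exact: vr.
apply: reach_trans; first by apply: (reach_le _ (@rewind_in_run _ _ _ _ _)); rewrite size_rev.
rewrite -map_rev map_sym_bits.
rewrite catrev_sym_rev; apply: reach_trans.
  by apply: (reach_le _ (@rewind_u_run _ _ _ _ _)); rewrite size_map size_rev sm.
rewrite -map_sym_bits map_rev catrev_rev cats0; apply: reach_trans.
  have := @rewind_v_run ([::], map sym w) ([::], map bit (pad m D)) (nseq n (Some false)) [::].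
  by rewrite map_nseq size_nseq; exact.
rewrite catrev_nseq cats0; apply: reach_trans.
  by apply: (reach_le _ (@rewind_out_run _ _ _ _ _)); rewrite size_rev.
rewrite catrev_sym_rev.
apply: reach_trans.
  rewrite /w map_sym_encode; move: r1; rewrite size_nseq map_nseq; exact.
move: r2; rewrite sm /result_word.
rewrite (map_cat _ (field true _ _)) (map_cat _ (field false _ _)).
rewrite map_sym_encode; exact.
Qed.
End Run.

(** Fillers and numbers of the input are written by two separate loops of the
    machine. *)
Lemma var_fields_cat m ss ss' :
  var_fields m (ss ++ ss') = var_fields m ss ++ var_fields (m + size ss) ss'.
Proof.
elim: ss m => [|s ss IH] m; first by rewrite addn0.
by rewrite -catA -addSnnS -IH.
Qed.

Lemma reduction_word x :
  gvb_encode (reduction x) = result_word (kls_K x) (kls_B x) (kls_size x).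
Proof.
rewrite reduction_encode /result_word /vars_word -/(kls_encode x).
rewrite /sizes map_cat map_nseq var_fields_cat !size_cat !size_nseq.
by rewrite addnA add1n addSn.
Qed.

Lemma reduction_polytime : @polytime kth_largest_subset (complement gvb) reduction.
Proof.
exists machine, 1000, 2 => x.
have [a [u [v r]]] := full_run (kls_K x) (kls_B x) (kls_size x).
rewrite -reduction_word in r.
exact: machine_computes r.
Qed.

(** * The reduction theorem *)

Theorem theorem3 : karp_reducible kth_largest_subset (complement gvb).
Proof.
exists reduction; split; first exact: reduction_polytime.
exact: reduction_correct.
Qed.
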